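(* Let $\lambda=([0,1],\kappa)$ be a flat curve whose modulus $m$ satisfies $\sum_{i=0}^\infty m(2^{-i})<\infty$. Then $\lambda$ is $1$-Ahlfors regular, and moreover $$\mathcal H^1_\kappa(\lambda)=\lim_{\|\sigma\|\to0}\sum_{k=0}^n\kappa(t_k,t_{k+1}),\qquad \sigma=\{0=t_0<t_1<\dots<t_{n+1}=1\},$$ and there is a constant $C<\infty$ such that for every interval $[s,t]\subset[0,1]$, $$|\mathcal H^1_\kappa([s,t])-\kappa(s,t)|\le C\,\kappa(s,t)\,M(\kappa(s,t)),\qquad M(l):=\sum_{i=0}^\infty m(Cl2^{-i}).$$
   Context: A quasi-metric on $[0,1]$ is a symmetric function $\kappa:[0,1]^2\to[0,\infty)$, vanishing exactly on the diagonal, with $\kappa(A,C)\le c(\kappa(A,B)+\kappa(B,C))$ for some constant $c\ge1$. The curve $\lambda=([0,1],\kappa)$ is called a flat curve, with modulus $m$, if $\kappa$ is a quasi-metric on $[0,1]$, continuous with respect to the usual topology, such that $$|\kappa(A,B)+\kappa(B,C)-\kappa(A,C)|\le m(\kappa(A,C))\,\kappa(A,C)\quad\text{for all }0\le A\le B\le C\le1,$$ where $m:[0,\infty)\to[0,\infty)$ is non-decreasing and $m(t)\searrow0$ as $t\searrow0$. $\mathcal H^1_\kappa(E)=\lim_{\varepsilon\to0}\inf\{\sum_i\operatorname{diam}_\kappa E_i: E\subset\bigcup_iE_i,\ \operatorname{diam}_\kappa E_i\le\varepsilon\}$. $\lambda$ is $1$-Ahlfors regular if there is $0<C'<\infty$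 with $C'^{-1}\kappa(A,B)\le\mathcal H^1_\kappa([A,B])\le C'\kappa(A,B)$ for all $[A,B]\subset[0,1]$. $\|\sigma\|=\max_k|t_{k+1}-t_k|$. *)

(* Defs.v *)
From HB Require Import structures.
From mathcomp Require Import all_boot all_order all_algebra.
From mathcomp Require Import all_classical all_reals all_analysis.

Set Implicit Arguments.
Unset Strict Implicit.
Unset Printing Implicit Defensive.

Import Order.TTheory GRing.Theory Num.Theory.
Import numFieldNormedType.Exports.

Local Open Scope classical_set_scope.
Local Open Scope ring_scope.

(* A function on [0,1]^2 (resp. [0,+oo[) is encoded as a total function on
   R^2 (resp. R); its values outside that domain are never constrained and
   are not used by any definition below. *)

Definition is_quasimetric (R : realType) (kappa : R -> R -> R) : Prop :=
  [/\ {in `[0, 1] &, forall A B, 0 <= kappa A B},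
      {in `[0, 1] &, forall A B, kappa A B = kappa B A},
      {in `[0, 1] &, forall A B, kappa A B = 0 <-> A = B} &
      exists2 c : R, 1 <= c &
        {in `[0, 1] & &, forall A B C,
          kappa A C <= c * (kappa A B + kappa B C)}].

(* Since m is non-decreasing on [0,+oo[, its convergence to 0 at 0 from the
   right is monotone, and it forces m 0 = 0. *)
Definition is_modulus (R : realType) (m : R -> R) : Prop :=
  [/\ (forall t, 0 <= t -> 0 <= m t),
      (forall t u, 0 <= t -> t <= u -> m t <= m u) &
      m t @[t --> 0^'+] --> (0 : R)].

Definition flat_curve (R : realType) (kappa : R -> R -> R) (m : R -> R) : Prop :=
  [/\ is_quasimetric kappa,
      {within `[0, 1] `*` `[0, 1],
        continuous (fun p : R * R => kappa p.1 p.2)},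
      is_modulus m &
      forall A B C, 0 <= A -> A <= B -> B <= C -> C <= 1 ->
        `|kappa A B + kappa B C - kappa A C| <= m (kappa A C) * kappa A C].

(* The element 0 is added so that the empty set has diameter 0 and not -oo;
   it changes nothing for a nonempty E contained in [0,1]. *)
Definition diam (R : realType) (kappa : R -> R -> R) (E : set R) : \bar R :=
  ereal_sup (0%E |` [set (kappa x y)%:E | x in E & y in E]).

(* Countable covers by subsets of the space [0,1]; finite covers are obtained
   by padding with empty sets. *)
Definition hausdorff1_content (R : realType) (kappa : R -> R -> R)
    (eps : R) (E : set R) : \bar R :=
  ereal_inf [set (\sum_(0 <= i <oo) diam kappa (F i))%E |
    F in [set F : (set R)^nat |
      [/\ (forall i, F i `<=` `[0, 1]),
          E `<=` \bigcup_i F i &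
          forall i, (diam kappa (F i) <= eps%:E)%E]]].

Definition hausdorff1 (R : realType) (kappa : R -> R -> R) (E : set R)
    : \bar R :=
  lim (hausdorff1_content kappa eps E @[eps --> 0^'+]).

Definition ahlfors1_regular (R : realType) (kappa : R -> R -> R) : Prop :=
  exists2 C' : R, 0 < C' &
    forall A B, 0 <= A -> A <= B -> B <= 1 ->
      ((C'^-1 * kappa A B)%:E <= hausdorff1 kappa `[A, B])%E /\
      (hausdorff1 kappa `[A, B] <= (C' * kappa A B)%:E)%E.

(* As in [itv_partition], a subdivision a = t_0 < t_1 < ... < t_{n+1} = b is
   represented by the sequence s = [:: t_1; ...; t_{n+1}], so that t_k is the
   k-th element of a :: s. *)
Definition mesh (R : realType) (a : R) (s : seq R) : R :=
  \big[Num.max/0]_(0 <= k < size s) `|(a :: s)`_k.+1 - (a :: s)`_k|.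

Definition kappa_sum (R : realType) (kappa : R -> R -> R) (a : R) (s : seq R)
    : R :=
  \sum_(0 <= k < size s) kappa (a :: s)`_k (a :: s)`_k.+1.

(* The filter, on subdivisions of [a,b], of "mesh tending to 0". *)
Definition mesh_to0 (R : realType) (a b : R) : set_system (seq R) :=
  filter_from [set d : R | 0 < d]
    (fun d => [set s | itv_partition a b s /\ mesh a s < d]).

Definition modulus_sum (R : realType) (m : R -> R) (C l : R) : \bar R :=
  (\sum_(0 <= i <oo) (m (C * l * 2 ^- i))%:E)%E.

(* Main.v *)
Require Import Defs.
From HB Require Import structures.
From mathcomp Require Import all_boot all_order all_algebra.
From mathcomp Require Import all_classical all_reals all_analysis.
From mathcomp Require Import ring lra.

Set Implicit Arguments.
Unset Strict Implicit.
Unset Printing Implicit Defensive.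

Import Order.TTheory GRing.Theory Num.Theory.
Import numFieldNormedType.Exports.

Local Open Scope classical_set_scope.
Local Open Scope ring_scope.

(** Let [S] denote the [kappa]-sum of a partition of [[a, b]] and [l = kappa a b].
    Cutting the partition at the first point whose distance from [a] exceeds
    [l / 2] leaves one single step and two sub-partitions of endpoint distance at
    most [7 / 10 * l], at the cost of a relative error [3 * m (2 * l)]; by
    induction [S] differs from [l] by a factor that the modulus series controls,
    uniformly in the partition.  Hence the upper limit [L x] of the [kappa]-sums
    of fine partitions of [[0, x]] satisfies [L t - L s = kappa s t * (1 + o(1))],
    which at once identifies it with the limit of the sums.  That [L t - L s] is
    the Hausdorff measure of [[s, t]] follows from covers by the intervals of a
    fine partition in one direction and, in the other, from the
    sigma-subadditivity of Lebesgue measure applied to the images under [L] of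
    the hulls of the sets of a cover. *)

(** * Sums of [kappa] along partitions *)

Section Sums.
Variables (R : realType) (kappa : R -> R -> R).

Lemma kappa_sum_nil a : kappa_sum kappa a [::] = 0.
Proof. by rewrite /kappa_sum big_geq. Qed.

Lemma kappa_sum_cons a x s :
  kappa_sum kappa a (x :: s) = kappa a x + kappa_sum kappa x s.
Proof. by rewrite /kappa_sum /= big_nat_recl. Qed.

Lemma kappa_sum_cat a s1 s2 : kappa_sum kappa a (s1 ++ s2) =
  kappa_sum kappa a s1 + kappa_sum kappa (last a s1) s2.
Proof.
elim: s1 a => [|x s1 IH] a /=; first by rewrite kappa_sum_nil add0r.
by rewrite !kappa_sum_cons IH addrA.
Qed.

Lemma kappa_sum_rcons a s x :
  kappa_sum kappa a (rcons s x) = kappa_sum kappa a s + kappa (last a s) x.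
Proof. by rewrite -cats1 kappa_sum_cat kappa_sum_cons kappa_sum_nil addr0. Qed.

Lemma path_le_last (a : R) s : path <=%R a s -> a <= last a s.
Proof.
elim: s a => //= x s IH a /andP[ax /IH]; exact: le_trans.
Qed.

End Sums.

(** Two relative errors, [3 * u] and [b], compose. Below, the product of the factors is at least
    [1 - 3 * u - b]. Above, the cross term [6 * u * b] is at most [3 * u] because [b <= 1 / 2]; the
    factor 2 in the upper bound leaves room for it. *)
Lemma relative_error_step (R : realFieldType) (l u b c T S : R) :
  0 <= l -> 0 <= u -> 0 <= b -> 3 * u + b <= c -> c <= 1 / 2 ->
  `|T - l| <= 3 * u * l -> (1 - b) * T <= S -> S <= (1 + 2 * b) * T ->
  (1 - c) * l <= S <= (1 + 2 * c) * l.
Proof.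
move=> l0 u0 b0 ubc c2; rewrite ler_norml => /andP[T1 T2] S1 S2.
have ub0 : 0 <= u * b by exact: mulr_ge0.
have ub2 : u * b <= u * (1 / 2) by rewrite ler_wpM2l//; lra.
apply/andP; split.
- apply: le_trans S1; apply: (@le_trans _ _ ((1 - b) * ((1 - 3 * u) * l))).
    by rewrite mulrA ler_wpM2r//; clear -ub0 ubc; lra.
  by rewrite ler_wpM2l//; clear -T1 b0 u0 ubc c2; lra.
- apply: le_trans S2 _; apply: (@le_trans _ _ ((1 + 2 * b) * ((1 + 3 * u) * l))).
    by rewrite ler_wpM2l//; clear -T2 b0; lra.
  by rewrite mulrA ler_wpM2r//; clear -ub2 ubc u0; lra.
Qed.

(** * Uniform estimate of the sums from an abstract error function [B] *)

Section FlatEstimate.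
Variables (R : realType) (kappa : R -> R -> R) (m B : R -> R).
Hypothesis kappa_ge0 : forall x y : R, 0 <= x -> x <= y -> y <= 1 -> 0 <= kappa x y.
Hypothesis kappa_refl : forall x : R, 0 <= x -> x <= 1 -> kappa x x = 0.
Hypothesis kappa_eq0 : forall x y : R, 0 <= x -> x <= y -> y <= 1 ->
  kappa x y = 0 -> x = y.
Hypothesis flat : forall x y z : R, 0 <= x -> x <= y -> y <= z -> z <= 1 ->
  `|kappa x y + kappa y z - kappa x z| <= m (kappa x z) * kappa x z.
Hypothesis m_ge0 : forall t : R, 0 <= t -> 0 <= m t.
Hypothesis m_le : forall t u : R, 0 <= t -> t <= u -> m t <= m u.
Hypothesis B_ge0 : forall t : R, 0 <= t -> 0 <= B t.
Hypothesis B_le : forall t u : R, 0 <= t -> t <= u -> B t <= B u.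
Hypothesis B_step : forall t : R, 0 <= t -> 3 * m (2 * t) + B (7 / 10 * t) <= B t.

Lemma kappa_sum_constant (a : R) s : 0 <= a -> a <= 1 -> path <=%R a s -> last a s = a ->
  kappa_sum kappa a s = 0.
Proof.
move=> a0 a1; elim: s => [|x s IH] /=; first by rewrite kappa_sum_nil.
move=> /andP[ax pxs] la.
have xa : x = a.
  by apply/le_anti; rewrite ax andbT; move: (path_le_last pxs); rewrite la.
by subst x; rewrite kappa_sum_cons kappa_refl// IH ?add0r.
Qed.

(** Strong induction on the number of points, with [B_step] as the recursion for the error. The
    condition [B <= 1 / 2] passes to both sub-partitions and keeps the modulus below [1 / 6]. Paths
    are only weakly increasing, so that a point can later be inserted even where it repeats a
    neighbour. *)
Lemma kappa_sum_bounds (a b : R) s : 0 <= a -> b <= 1 -> path <=%R a s ->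
  last a s = b -> B (kappa a b) <= 1 / 2 ->
  (1 - B (kappa a b)) * kappa a b <= kappa_sum kappa a s
    <= (1 + 2 * B (kappa a b)) * kappa a b.
Proof.
elim/(@ltn_ind): (size s).+1 {-2}s (ltnSn (size s)) a b => n IH {}s szs a b.
move=> a0 b1 ps E Bl.
have ab : a <= b by rewrite -E path_le_last.
have l0 : 0 <= kappa a b by exact: kappa_ge0.
have [l00|ln0] := eqVneq (kappa a b) 0.
  have e : b = a by apply/esym/kappa_eq0.
  rewrite kappa_sum_constant ?l00 ?mulr0 ?lexx//; last by rewrite E.
  exact: le_trans ab b1.
have {}l0 : 0 < kappa a b by rewrite lt_neqAle eq_sym ln0.
have l2 : kappa a b <= 2 * kappa a b by lra.
have st := B_step (ltW l0).
have mu0 : 0 <= m (2 * kappa a b) by exact: m_ge0 (le_trans (ltW l0) l2).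
have b0 : 0 <= B (7 / 10 * kappa a b) by apply: B_ge0; rewrite mulr_ge0 ?(ltW l0)//; lra.
have ml := m_le (ltW l0) l2.
have mu6 : m (2 * kappa a b) <= 1 / 6 by lra.
(* The step that crosses the half-way distance is never subdivided further. *)
have : has (fun x => kappa a b / 2 < kappa a x) s.
  apply/hasP; exists b; last lra.
  move: ln0; rewrite -E; case: (s) => [/=|x s' _]; last by rewrite /= mem_last.
  by rewrite kappa_refl ?eqxx// (le_trans ab).
move E' : s => s' hs; case: (split_find hs) E' => x s1 s2 ax nh E'.
rewrite {hs}.
subst s; move: ps szs E.
rewrite cat_path rcons_path last_cat last_rcons size_cat size_rcons.
move=> /andP[/andP[ps1 yx] ps2] szs E.
set y := last a s1 in yx *.
rewrite /= in ax.
have ay : a <= y by exact: path_le_last.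
have xb : x <= b by rewrite -E path_le_last.
have y0 : 0 <= y by exact: le_trans ay.
have x0 : 0 <= x by exact: le_trans yx.
have x1 : x <= 1 by exact: le_trans b1.
have y1 : y <= 1 by exact: le_trans x1.
have yb : y <= b by exact: le_trans xb.
have ax' : a <= x by exact: le_trans yx.
have k1 : kappa a y <= kappa a b / 2.
  rewrite /y; case: (s1) nh => [|z s1' nh /=].
    by rewrite /= kappa_refl ?(le_trans ab)// => _; lra.
  rewrite leNgt; by apply: (hasPn nh); rewrite mem_last.
have p1 := kappa_ge0 a0 ay y1.
have p2 := kappa_ge0 y0 yx x1.
have p3 := kappa_ge0 x0 xb b1.
have q0 := kappa_ge0 y0 yb b1.
set l := kappa a b in ax Bl l0 ln0 k1 l2 st mu0 b0 ml mu6 *.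
set mu := m (2 * l) in st mu0 ml mu6.
have f1 := flat a0 ay yb b1.
have f2 := flat y0 yx xb b1.
have f3 := flat a0 ax' xb b1.
rewrite -/l in f1 f3.
have mll : m l * l <= mu * l by rewrite ler_wpM2r// ltW.
have mul6 : mu * l <= 1 / 6 * l by rewrite ler_wpM2r ?(ltW l0).
have q2 : kappa y b <= 2 * l.
  by move: f1; rewrite ler_norml => /andP[_]; clear -p1 mll mul6 l0; lra.
have mq : m (kappa y b) * kappa y b <= mu * (2 * l).
  by apply: ler_pM => //; [exact: m_ge0|exact: m_le].
(* Flatness at [a], [x], [b] gives at most (1 + 1/6 - 1/2) l = 2/3 l. The ratio 7/10 lies between
   2/3 and the square root of 1/2; the latter bound matters in [flat_bound_step]. *)
have k3 : kappa x b <= 7 / 10 * l.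
  by move: f3; rewrite ler_norml => /andP[_]; clear -ax mll mul6 l0; lra.
have k1' : kappa a y <= 7 / 10 * l by lra.
have B1 := B_le p1 k1'; have B3 := B_le p3 k3.
have B2 : B (7 / 10 * l) <= 1 / 2 by lra.
have /andP[I1 I1'] : (1 - B (kappa a y)) * kappa a y <= kappa_sum kappa a s1
    <= (1 + 2 * B (kappa a y)) * kappa a y.
  apply: (IH (size s1).+1) => //; last exact: le_trans B2.
  by rewrite (leq_trans _ szs)// -addSn ltnS leq_addr.
have /andP[I3 I3'] : (1 - B (kappa x b)) * kappa x b <= kappa_sum kappa x s2
    <= (1 + 2 * B (kappa x b)) * kappa x b.
  apply: (IH (size s2).+1) => //; last exact: le_trans B2.
  by rewrite (leq_trans _ szs)// addSn !ltnS leq_addl.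
rewrite kappa_sum_cat kappa_sum_rcons last_rcons -/y.
set b' := B (7 / 10 * l) in st b0 B1 B3 B2.
have J1 : B (kappa a y) * kappa a y <= b' * kappa a y by rewrite ler_wpM2r.
have J3 : B (kappa x b) * kappa x b <= b' * kappa x b by rewrite ler_wpM2r.
have J2 : 0 <= b' * kappa y x by rewrite mulr_ge0.
(* The three-step sum differs from [l] by at most [mu * l] (flatness at [a], [y], [b]) plus
   [mu * (2 * l)] (flatness at [y], [x], [b]), whence [3 * mu * l]. *)
apply: (@relative_error_step _ l mu b' _ (kappa a y + kappa y x + kappa x b)) => //.
- exact: ltW.
- move: f1 f2 mll mq; rewrite !ler_norml; clear => /andP[? ?] /andP[? ?] ? ?.
  by apply/andP; split; lra.
- by clear -I1 I3 J1 J2 J3; lra.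
- by clear -I1' I3' J1 J2 J3; lra.
Qed.

End FlatEstimate.

(** * The modulus series and a concrete error function *)

Section ModulusSum.
Variables (R : realType) (m : R -> R).
Hypothesis hm : is_modulus m.
Hypothesis hsum : (\sum_(0 <= i <oo) (m (2 ^- i))%:E < +oo)%E.

Definition fine_modulus_sum (l : R) : R := fine (modulus_sum m 1 l).

Lemma modulus_term_ge0 (l : R) (i : nat) : 0 <= l -> 0 <= m (l * 2 ^- i).
Proof. by case: hm => + _ _ l0; apply; rewrite mulr_ge0// invr_ge0 exprn_ge0. Qed.

Lemma modulus_sum_rescale (C l : R) : modulus_sum m C l = modulus_sum m 1 (C * l).
Proof. by rewrite /modulus_sum mul1r. Qed.

Lemma modulus_sum_ge0 (l : R) : 0 <= l -> (0 <= modulus_sum m 1 l)%E.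
Proof.
move=> l0; apply: nneseries_ge0 => i _ _.
by rewrite lee_fin mul1r modulus_term_ge0.
Qed.

Lemma modulus_sum_tail (l : R) (n : nat) : 0 <= l ->
  modulus_sum m 1 (l * 2 ^- n) = (\sum_(n <= i <oo) (m (l * 2 ^- i))%:E)%E.
Proof.
move=> l0; rewrite /modulus_sum -(@nneseries_addn _ (fun i => (m (l * 2 ^- i))%:E) n); last first.
  by move=> i; rewrite lee_fin modulus_term_ge0.
apply: eq_eseriesr => i _; congr (m _)%:E.
by rewrite mul1r addnC exprD invfM mulrA.
Qed.

Lemma modulus_sum_halve (l : R) : 0 <= l ->
  modulus_sum m 1 l = ((m l)%:E + modulus_sum m 1 (l / 2))%E.
Proof.
move=> l0; rewrite -(expr1 2) modulus_sum_tail// {1}/modulus_sum.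
rewrite nneseries_recl//; last by move=> k _; rewrite lee_fin mul1r modulus_term_ge0.
by rewrite mul1r expr0 invr1 mulr1.
Qed.

Lemma modulus_sum_le (l l' : R) : 0 <= l -> l <= l' ->
  (modulus_sum m 1 l <= modulus_sum m 1 l')%E.
Proof.
move=> l0 ll'; apply: lee_nneseries => i _.
  by rewrite lee_fin mul1r modulus_term_ge0.
rewrite !mul1r lee_fin; case: hm => _ h _; apply: h.
  by rewrite mulr_ge0// invr_ge0 exprn_ge0.
by rewrite ler_wpM2r// invr_ge0 exprn_ge0.
Qed.

(** The hypothesis is finiteness at 1. Doubling the argument adds one finite term, and by
    monotonicity powers of 2 suffice. *)
Lemma modulus_sum_fin (l : R) : 0 <= l -> modulus_sum m 1 l \is a fin_num.
Proof.
move=> l0; rewrite ge0_fin_numE ?modulus_sum_ge0//.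
have pow (n : nat) : (modulus_sum m 1 (2 ^+ n) < +oo)%E.
  elim: n => [|n IH].
    rewrite expr0 /modulus_sum; under eq_eseriesr do rewrite !mul1r.
    exact: hsum.
  rewrite modulus_sum_halve ?exprn_ge0// exprS mulrAC divff ?mul1r//.
  by rewrite lte_add_pinfty// ltry.
have /ltW lb := archi_boundP l0.
apply: (le_lt_trans (modulus_sum_le l0 (le_trans lb _)) (pow (Num.bound l))).
by rewrite -natrX ler_nat ltnW// ltn_expl.
Qed.

Lemma modulus_sumE (C l : R) : 0 <= C -> 0 <= l ->
  modulus_sum m C l = (fine_modulus_sum (C * l))%:E.
Proof.
by move=> C0 l0; rewrite modulus_sum_rescale /fine_modulus_sum fineK// modulus_sum_fin// mulr_ge0.
Qed.

(** The value at [2 ^- N] is the [N]-th tail of the convergent series at 1. *)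
Lemma modulus_sum_small (e : R) : 0 < e -> exists2 d, 0 < d & fine_modulus_sum d <= e.
Proof.
move=> e0.
have : (\sum_(N <= i <oo) (m (1 * 2 ^- i))%:E @[N --> \oo] --> 0)%E.
  apply: nneseries_tail_cvg => [|i _]; last by rewrite lee_fin modulus_term_ge0.
  by under eq_eseriesr do rewrite mul1r.
move=> /fine_cvgP[_] /cvgrPdist_le /(_ _ e0)[N _ /(_ N (leqnn N))/=].
rewrite -modulus_sum_tail// mul1r sub0r normrN => h.
by exists (2 ^- N); [rewrite invr_gt0 exprn_gt0|exact: le_trans (ler_norm _) h].
Qed.

(** Designed to satisfy [B_step]. Write M for [fine_modulus_sum]. Passing from [l] to [7 / 10 * l]
    turns the pair M(2l), M(7/10 2l) into M(7/10 2l) and a term at most M(l), so the loss is at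
    least 3 (M(2l) - M(l)), which is exactly [3 * m (2 * l)]. *)
Definition flat_bound (l : R) : R :=
  3 * (fine_modulus_sum (2 * l) + fine_modulus_sum (7 / 10 * (2 * l))).

Lemma fine_modulus_sum_ge0 (l : R) : 0 <= l -> 0 <= fine_modulus_sum l.
Proof. by move=> l0; rewrite /fine_modulus_sum fine_ge0// modulus_sum_ge0. Qed.

Lemma fine_modulus_sum_le (l l' : R) : 0 <= l -> l <= l' -> fine_modulus_sum l <= fine_modulus_sum l'.
Proof.
move=> l0 ll'; rewrite /fine_modulus_sum fine_le ?modulus_sum_fin ?modulus_sum_le//.
exact: le_trans ll'.
Qed.

Lemma flat_bound_ge0 (l : R) : 0 <= l -> 0 <= flat_bound l.
Proof. by move=> l0; rewrite mulr_ge0// addr_ge0// fine_modulus_sum_ge0// !mulr_ge0. Qed.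

Lemma flat_bound_le (l l' : R) : 0 <= l -> l <= l' -> flat_bound l <= flat_bound l'.
Proof.
by move=> l0 ll'; rewrite ler_wpM2l// lerD// fine_modulus_sum_le ?mulr_ge0// !ler_wpM2l// ?mulr_ge0.
Qed.

(* Two contractions by 7/10 amount to more than a halving, (7/10)^2 < 1/2. *)
Lemma flat_bound_step (l : R) : 0 <= l ->
  3 * m (2 * l) + flat_bound (7 / 10 * l) <= flat_bound l.
Proof.
move=> l0; rewrite /flat_bound.
have e : fine_modulus_sum (2 * l) = m (2 * l) + fine_modulus_sum l.
  rewrite /fine_modulus_sum modulus_sum_halve ?mulr_ge0// mulrAC divff ?mul1r//.
  by rewrite fineD// modulus_sum_fin.
have h : fine_modulus_sum (7 / 10 * (2 * (7 / 10 * l))) <= fine_modulus_sum l by apply: fine_modulus_sum_le; lra.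
have -> : 2 * (7 / 10 * l) = 7 / 10 * (2 * l) by ring.
rewrite e; move: h; have -> : 2 * (7 / 10 * l) = 7 / 10 * (2 * l) by ring.
lra.
Qed.

Lemma flat_bound_le_modulus_sum (l : R) : 0 <= l -> flat_bound l <= 6 * fine_modulus_sum (2 * l).
Proof.
move=> l0; rewrite /flat_bound.
have : fine_modulus_sum (7 / 10 * (2 * l)) <= fine_modulus_sum (2 * l) by apply: fine_modulus_sum_le; lra.
lra.
Qed.

Lemma flat_bound_small (e : R) : 0 < e -> exists2 d, 0 < d & flat_bound d <= e.
Proof.
move=> e0; have [d d0 h] := @modulus_sum_small (e / 6) ltac:(lra).
exists (d / 2); first lra.
apply: le_trans (flat_bound_le_modulus_sum _) _; first lra.
by rewrite mulrCA divff// mulr1; lra.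
Qed.

End ModulusSum.

(** * Fine partitions and the length function of a flat curve *)

Section FlatCurve.
Variables (R : realType) (kappa : R -> R -> R) (m : R -> R).
Hypothesis hflat : flat_curve kappa m.
Hypothesis hsum : (\sum_(0 <= i <oo) (m (2 ^- i))%:E < +oo)%E.

Local Notation B := (flat_bound m).
Local Notation S := (kappa_sum kappa).

Lemma flat_modulus : is_modulus m. Proof. by case: hflat. Qed.

Lemma kappa_ge0 (x y : R) : 0 <= x -> x <= 1 -> 0 <= y -> y <= 1 -> 0 <= kappa x y.
Proof.
by move=> *; case: hflat => -[h _ _ _] _ _ _; apply: h; rewrite in_itv/=; apply/andP.
Qed.

Lemma kappaC (x y : R) : 0 <= x -> x <= 1 -> 0 <= y -> y <= 1 -> kappa x y = kappa y x.
Proof.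
by move=> *; case: hflat => -[_ h _ _] _ _ _; apply: h; rewrite in_itv/=; apply/andP.
Qed.

Lemma kappa_eq0 (x y : R) : 0 <= x -> x <= 1 -> 0 <= y -> y <= 1 ->
  kappa x y = 0 <-> x = y.
Proof.
by move=> *; case: hflat => -[_ _ h _] _ _ _; apply: h; rewrite in_itv/=; apply/andP.
Qed.

Lemma kappaxx (x : R) : 0 <= x -> x <= 1 -> kappa x x = 0.
Proof. by move=> x0 x1; apply/kappa_eq0. Qed.

Lemma flat_bounds (a b : R) s : 0 <= a -> b <= 1 -> path <=%R a s ->
  last a s = b -> B (kappa a b) <= 1 / 2 ->
  (1 - B (kappa a b)) * kappa a b <= S a s <= (1 + 2 * B (kappa a b)) * kappa a b.
Proof.
case: hflat => _ _ [m0 mle _] hf.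
apply: (@kappa_sum_bounds R kappa m B) => //.
- by move=> x y x0 xy y1; apply: kappa_ge0 => //; [exact: le_trans y1|exact: le_trans xy].
- exact: kappaxx.
- move=> x y x0 xy y1 e; apply/(kappa_eq0 _ _ _ _) => //;
    [exact: le_trans y1|exact: le_trans xy].
- exact: (flat_bound_ge0 flat_modulus).
- exact: (flat_bound_le flat_modulus).
- exact: (flat_bound_step flat_modulus).
Qed.

(** Substitute for monotonicity of [kappa] under inclusion of intervals: bound the sum along [a],
    [x], [y], [c] and drop the two outer terms. *)
Lemma sub_kappa_le (a x y c : R) : 0 <= a -> a <= x -> x <= y -> y <= c -> c <= 1 ->
  B (kappa a c) <= 1 / 2 -> kappa x y <= (1 + 2 * B (kappa a c)) * kappa a c.
Proof.
move=> a0 ax xy yc c1 Bl.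
have /andP[_] := @flat_bounds a c [:: x; y; c] a0 c1 ltac:(by rewrite /= ax xy yc) erefl Bl.
rewrite !kappa_sum_cons kappa_sum_nil /=.
have : 0 <= kappa a x by apply: kappa_ge0 => //; lra.
have : 0 <= kappa y c by apply: kappa_ge0 => //; lra.
lra.
Qed.

Lemma kappa_cont (a b e : R) : 0 <= a -> a <= 1 -> 0 <= b -> b <= 1 -> 0 < e ->
  exists2 d, 0 < d & forall x y, 0 <= x -> x <= 1 -> 0 <= y -> y <= 1 ->
    `|a - x| < d -> `|b - y| < d -> `|kappa a b - kappa x y| < e.
Proof.
move=> a0 a1 b0 b1 e0; case: hflat => _ /subspace_continuousP h _ _.
have /h /cvgrPdist_lt/(_ _ e0) : (`[0, 1] `*` `[0, 1]) (a, b).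
  by split; rewrite /= in_itv/=; apply/andP.
rewrite near_withinE => /nbhs_ballP[d /= d0 hd].
exists d => // x y x0 x1 y0 y1 xa yb.
by apply: (hd (x, y)) => //; split; rewrite /= in_itv/=; apply/andP.
Qed.

(** Compactness of [0,1] makes continuity at the diagonal points uniform. The radii are halved so
    that both arguments stay in the ball around the centre. *)
Lemma kappa_near_diagonal (e : R) : 0 < e ->
  exists2 d, 0 < d & forall x y, 0 <= x -> x <= 1 -> 0 <= y -> y <= 1 ->
    `|x - y| < d -> kappa x y <= e.
Proof.
move=> e0.
have /compact_near_coveringP/near_covering_withinP := @segment_compact R 0 1.
move=> /(_ _ (0 : R)^'+ (fun d x => forall y, 0 <= y -> y <= 1 ->
    `|x - y| < d -> kappa x y <= e) _).
case.
  move=> x /=; rewrite in_itv/= => /andP[x0 x1].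
  have [d d0 hd] := kappa_cont x0 x1 x0 x1 e0.
  exists (ball x (d / 2), [set r | r < d / 2]).
    split => /=; first by apply: nbhsx_ballx; lra.
    by apply: nbhs_right_lt; lra.
  move=> [x' r] /= [xx' rd]; rewrite in_itv/= => /andP[x'0 x'1] y y0 y1 xy.
  move: xx'; rewrite /ball/= => xx'.
  have := hd x' y x'0 x'1 y0 y1.
  rewrite kappaxx// sub0r normrN => /(_ _ _)/ltW h.
  apply: le_trans (ler_norm _) (h _ _); first lra.
  rewrite (_ : x - y = (x - x') + (x' - y)); last by ring.
  apply: le_lt_trans (ler_normD _ _) _; lra.
move=> d /= d0 h.
exists (d / 2); first lra.
move=> x y x0 x1 y0 y1 xy; apply: (h (d / 2)) => //=.
- by rewrite sub0r normrN gtr0_norm; lra.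
- lra.
- by rewrite in_itv/=; apply/andP.
Qed.

(** Fineness is measured by [kappa], the quantity on which the error [B] depends; [mesh_fine_path]
    converts from the mesh. *)
Definition fine_step (e : R) : rel R := fun x y => (x <= y) && (kappa x y <= e).

Lemma fine_step_le e : subrel (fine_step e) <=%R.
Proof. by move=> x y /andP[]. Qed.

Lemma fine_step_mono e e' : e <= e' -> subrel (fine_step e) (fine_step e').
Proof. by move=> ee' x y /andP[xy k]; rewrite /fine_step xy (le_trans k). Qed.

Lemma fine_path_exists (s t e : R) : 0 <= s -> s <= t -> t <= 1 -> 0 < e ->
  exists2 c, path (fine_step e) s c & last s c = t.
Proof.
move=> s0 st t1 e0; have [d d0 hd] := kappa_near_diagonal e0.
have [n tsn] : exists n, t - s <= n%:R * (d / 2).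
  exists (Num.bound ((t - s) / (d / 2))); rewrite -ler_pdivrMr; last lra.
  by apply/ltW/archi_boundP; apply: divr_ge0; lra.
elim: n s s0 st tsn => [|n IH] s s0 st.
  by rewrite mul0r => ts; exists [::] => //=; lra.
rewrite -natr1 mulrDl mul1r => tsn.
have [ts|ts] := leP t (s + d / 2).
  exists [:: t] => //=; rewrite andbT /fine_step st hd//; try lra.
  by rewrite ler0_norm; lra.
have [|||c pc lc] := IH (s + d / 2); [lra|lra|lra|].
exists (s + d / 2 :: c) => //=; rewrite pc andbT; apply/andP; split; first lra.
by apply: hd; rewrite ?ler0_norm; lra.
Qed.

Definition eventual_bound (x y : R) := exists2 e : R, 0 < e &
  forall c, path (fine_step e) 0 c -> last 0 c = x -> S 0 c <= y.

(* An upper limit along finer and finer partitions; that it is a limit only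
   follows from [length_path]. *)
Definition length_upto (x : R) := inf [set y | eventual_bound x y].

Lemma kappa_sum_ge0 (a : R) c : 0 <= a -> last a c <= 1 -> path <=%R a c ->
  0 <= S a c.
Proof.
elim: c a => [|x c IH] a a0 /=; first by rewrite kappa_sum_nil.
move=> c1 /andP[ax pc]; have := path_le_last pc.
by move=> xl; rewrite kappa_sum_cons addr_ge0 ?IH ?kappa_ge0//; lra.
Qed.

Lemma eventual_bound_ge0 (x y : R) : 0 <= x -> x <= 1 -> eventual_bound x y -> 0 <= y.
Proof.
move=> x0 x1 [e e0 h]; have [c pc lc] := fine_path_exists (lexx 0) x0 x1 e0.
apply: le_trans (h c pc lc); apply: kappa_sum_ge0; rewrite ?lc//.
by apply: sub_path pc; exact: fine_step_le.
Qed.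

(** A fine partition of [0,t] need not contain [s]. Inserting [s] into the step from [p] to [x] that
    crosses it changes the sum little; the part up to [s] is then bounded by [y], and the part from
    [s] on by [flat_bounds]. *)
Lemma eventual_bound_up (s t y e : R) : 0 <= s -> s <= t -> t <= 1 ->
  B (kappa s t) <= 1 / 2 -> 0 < e -> eventual_bound s y ->
  eventual_bound t (y + (1 + 2 * B (kappa s t)) * kappa s t + e).
Proof.
move=> s0 st t1 Bst e0 ys.
have y0 : 0 <= y by apply: eventual_bound_ge0 ys => //; lra.
case: ys => u u0 hy.
have kst0 : 0 <= kappa s t by apply: kappa_ge0; lra.
have Bst0 := flat_bound_ge0 flat_modulus kst0.
have [d d0 Bd] := @flat_bound_small R m flat_modulus hsum (1 / 2) ltac:(lra).
(* The bound [d] makes [B <= 1 / 2] on the crossing step, [u / 2] keeps the step from [p] to [s]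
   within [u] although it may be twice as large as the one from [p] to [x], and [e] absorbs the cost
   of the insertion. *)
pose v := Num.min d (Num.min (u / 2) e).
have v0 : 0 < v by rewrite !lt_min d0 e0; lra.
have [vd vu ve] : [/\ v <= d, v <= u / 2 & v <= e].
  by rewrite /v; split; rewrite !ge_min lexx ?orbT.
exists v => // c pc lc.
have pc' : path <=%R 0 c by apply: sub_path pc; exact: fine_step_le.
case: c => [|c0 c'] in pc lc pc' *.
  rewrite kappa_sum_nil !addr_ge0 ?(ltW e0)// mulr_ge0//; lra.
move E : (c0 :: c') => c in pc lc pc' *.
have : has (fun x => s <= x) c.
  by apply/hasP; exists t => //; rewrite -lc -E /= mem_last.
move=> hs; case: (split_find hs) pc pc' lc {E} => x c1 c2 sx nh.
rewrite !cat_path !rcons_path last_cat last_rcons.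
move=> /andP[/andP[p1 px] p2] /andP[/andP[p1' px'] p2'] lc {hs}.
set p := last 0 c1 in px px'.
have p0 : 0 <= p by exact: path_le_last.
have xt : x <= t by rewrite -lc; exact: path_le_last.
have ps : p <= s.
  rewrite /p; case: (c1) nh => [//|z c1' nh /=].
  by rewrite ltW// ltNge; apply: (hasPn nh); rewrite mem_last.
case/andP: px => _ kpx.
rewrite kappa_sum_cat kappa_sum_rcons last_rcons -/p.
have x1 : x <= 1 by exact: le_trans t1.
have x0 : 0 <= x by exact: le_trans sx.
have kpx0 : 0 <= kappa p x by apply: kappa_ge0 => //; exact: le_trans x1.
have Bpx : B (kappa p x) <= 1 / 2.
  by apply: le_trans Bd; apply: (flat_bound_le flat_modulus hsum) => //; exact: le_trans vd.
have Bpx0 := flat_bound_ge0 flat_modulus kpx0.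
have Bk : B (kappa p x) * kappa p x <= 1 / 2 * kappa p x by rewrite ler_wpM2r.
have kps := @sub_kappa_le p p s x p0 (lexx p) ps sx x1 Bpx.
have /andP[ins _] := @flat_bounds p x [:: s; x] p0 x1
  ltac:(by rewrite /= ps sx) erefl Bpx.
rewrite !kappa_sum_cons kappa_sum_nil in ins.
have /andP[_ h2] := @flat_bounds s t (x :: c2) s0 t1
  ltac:(by rewrite /= sx p2') lc Bst.
rewrite kappa_sum_cons in h2.
have : S 0 (rcons c1 s) <= y.
  apply: hy; last by rewrite last_rcons.
  rewrite rcons_path -/p /fine_step ps /=; apply/andP; split; last lra.
  by apply: sub_path p1; apply: fine_step_mono; lra.
rewrite kappa_sum_rcons -/p; lra.
Qed.

(** Extend any fine partition of [0,s] by a fine partition of [s,t], whose sum is bounded below by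
    [flat_bounds]. *)
Lemma eventual_bound_down (s t y : R) : 0 <= s -> s <= t -> t <= 1 ->
  B (kappa s t) <= 1 / 2 -> eventual_bound t y ->
  eventual_bound s (y - (1 - B (kappa s t)) * kappa s t).
Proof.
move=> s0 st t1 Bst [u u0 hy]; exists u => // c pc lc.
have [c' pc' lc'] := fine_path_exists s0 st t1 u0.
have /andP[h _] := flat_bounds s0 t1 (sub_path (@fine_step_le u) pc') lc' Bst.
have := hy (c ++ c'); rewrite cat_path pc last_cat lc => /(_ pc' lc').
rewrite kappa_sum_cat lc; lra.
Qed.

(** [eventual_bound_up] reaches only points at small distance, so the bound is carried from 0 to [x]
    along a fine partition. *)
Lemma eventual_bound_nonempty (x : R) : 0 <= x -> x <= 1 ->
  exists y, eventual_bound x y.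
Proof.
move=> x0 x1.
have [d d0 Bd] := @flat_bound_small R m flat_modulus hsum (1 / 2) ltac:(lra).
have [c pc lc] := fine_path_exists (lexx 0) x0 x1 d0.
have e0 : exists y, eventual_bound 0 y.
  exists 0, 1 => // c' pc' lc'.
  rewrite (kappa_sum_constant _ _ _ _ lc')//; first exact: kappaxx.
  by apply: sub_path pc'; exact: fine_step_le.
suff gen a : 0 <= a -> last a c <= 1 -> (exists y, eventual_bound a y) ->
    path (fine_step d) a c -> exists y, eventual_bound (last a c) y.
  by rewrite -lc; apply: gen => //; rewrite lc.
elim: c a {x0 x1 pc lc e0} => [//|z c IH] a a0 /= c1 [y ya] /andP[/andP[az kaz] pc].
have z1 : z <= 1.
  by apply: le_trans c1; apply: path_le_last; apply: sub_path pc; exact: fine_step_le.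
apply: (IH z) => //; first lra.
exists (y + (1 + 2 * B (kappa a z)) * kappa a z + 1).
apply: eventual_bound_up => //; apply: le_trans Bd.
by apply: (flat_bound_le flat_modulus hsum) => //; apply: kappa_ge0; lra.
Qed.

Lemma length_increment (s t : R) : 0 <= s -> s <= t -> t <= 1 ->
  B (kappa s t) <= 1 / 2 ->
  (1 - B (kappa s t)) * kappa s t <= length_upto t - length_upto s
    <= (1 + 2 * B (kappa s t)) * kappa s t.
Proof.
move=> s0 st t1 Bst.
have lb x : 0 <= x -> x <= 1 -> has_lbound [set y | eventual_bound x y].
  by move=> x0 x1; exists 0 => y; exact: eventual_bound_ge0.
have ne x : 0 <= x -> x <= 1 -> [set y | eventual_bound x y] !=set0.
  by move=> x0 x1; have [y] := eventual_bound_nonempty x0 x1; exists y.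
apply/andP; split.
  suff : length_upto s + (1 - B (kappa s t)) * kappa s t <= length_upto t by lra.
  apply: lb_le_inf; first by apply: ne; lra.
  move=> y /(eventual_bound_down s0 st t1 Bst) h.
  suff : length_upto s <= y - (1 - B (kappa s t)) * kappa s t by lra.
  by apply: ge_inf => //; apply: lb; lra.
suff : length_upto t - (1 + 2 * B (kappa s t)) * kappa s t <= length_upto s by lra.
apply: lb_le_inf; first by apply: ne; lra.
move=> y hy; apply/ler_addgt0Pr => e e0.
have := eventual_bound_up s0 st t1 Bst e0 hy => h.
suff : length_upto t <= y + (1 + 2 * B (kappa s t)) * kappa s t + e by lra.
by apply: ge_inf => //; apply: lb; lra.
Qed.

(** Telescoping of [length_increment], each step having error at most [B e]. *)
Lemma length_path (e a : R) c : 0 <= a -> last a c <= 1 -> B e <= 1 / 2 ->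
  path (fine_step e) a c ->
  (1 - B e) * S a c <= length_upto (last a c) - length_upto a
    <= (1 + 2 * B e) * S a c.
Proof.
move=> + + Be; elim: c a => [|x c IH] a a0 /= c1.
  by rewrite kappa_sum_nil !mulr0 subrr lexx.
move=> /andP[/andP[ax kax] pc].
have x1 : x <= 1.
  by apply: le_trans c1; apply: path_le_last; apply: sub_path pc; exact: fine_step_le.
have x0 : 0 <= x by lra.
have k0 : 0 <= kappa a x by apply: kappa_ge0; lra.
have Bk : B (kappa a x) <= B e by exact: (flat_bound_le flat_modulus hsum).
have /andP[i1 i2] := IH x x0 c1 pc.
have /andP[j1 j2] := length_increment a0 ax x1 (le_trans Bk Be).
have : B (kappa a x) * kappa a x <= B e * kappa a x by rewrite ler_wpM2r.
rewrite kappa_sum_cons; lra.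
Qed.

Lemma length_upto_le (s t : R) : 0 <= s -> s <= t -> t <= 1 ->
  length_upto s <= length_upto t.
Proof.
move=> s0 st t1.
have [d d0 Bd] := @flat_bound_small R m flat_modulus hsum (1 / 2) ltac:(lra).
have [c pc lc] := fine_path_exists s0 st t1 d0.
rewrite -lc in t1; have /andP[h _] := length_path s0 t1 Bd pc.
rewrite -subr_ge0 -lc (le_trans _ h)// mulr_ge0//; first lra.
by apply: kappa_sum_ge0 => //; apply: sub_path pc; exact: fine_step_le.
Qed.

End FlatCurve.

(** * Hausdorff measure of intervals *)

Lemma within_itv_continuous (R : realType) (f : R -> R) (a b : R) :
  (forall x e, a <= x -> x <= b -> 0 < e -> exists2 d, 0 < d &
    forall y, a <= y -> y <= b -> `|x - y| < d -> `|f x - f y| < e) ->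
  {within `[a, b], continuous f}.
Proof.
move=> h; apply/subspace_continuousP => x /=; rewrite in_itv/= => /andP[ax xb].
apply/cvgrPdist_lt => e e0; have [d d0 hd] := h x e ax xb e0.
rewrite near_withinE; apply/nbhs_ballP; exists d => //= y xy.
by rewrite in_itv/= => /andP[ay yb]; apply: hd.
Qed.

Section Hausdorff.
Variables (R : realType) (kappa : R -> R -> R) (m : R -> R).
Hypothesis hflat : flat_curve kappa m.
Hypothesis hsum : (\sum_(0 <= i <oo) (m (2 ^- i))%:E < +oo)%E.

Local Notation B := (flat_bound m).
Local Notation S := (kappa_sum kappa).
Local Notation L := (length_upto kappa).

Let hm := flat_modulus hflat.

(** Needed for the intermediate value theorem: [L] maps [s,t] onto [L s, L t]. *)
Lemma length_upto_continuous : {within `[0, 1], continuous L}.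
Proof.
apply: within_itv_continuous => x e x0 x1 e0.
have [d d0 Bd] := @flat_bound_small R m hm hsum (1 / 2) ltac:(lra).
have v0 : 0 < Num.min d (e / 3) by rewrite lt_min d0; lra.
have [r r0 hr] := kappa_cont hflat x0 x1 x0 x1 v0.
exists r => // y y0 y1 xy.
have key (s t : R) : 0 <= s -> s <= t -> t <= 1 -> `|x - s| < r -> `|x - t| < r ->
    0 <= L t - L s < e.
  move=> s0 st t1 xs xt.
  have s1 : s <= 1 by exact: le_trans t1.
  have t0 : 0 <= t by exact: le_trans st.
  have k0 : 0 <= kappa s t by exact: (kappa_ge0 hflat).
  have := hr s t s0 s1 t0 t1 xs xt.
  rewrite (kappaxx hflat)// sub0r normrN ger0_norm// lt_min => /andP[kd ke].
  have Bk : B (kappa s t) <= 1 / 2.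
    by apply: le_trans Bd; apply: (flat_bound_le hm hsum) => //; lra.
  have /andP[_ h2] := length_increment hflat hsum s0 st t1 Bk.
  have : B (kappa s t) * kappa s t <= 1 / 2 * kappa s t by rewrite ler_wpM2r.
  have := length_upto_le hflat hsum s0 st t1.
  lra.
have xx : `|x - x| < r by rewrite subrr normr0.
have [h|/ltW h] := leP x y.
  by have := key x y x0 h y1 xx xy; rewrite distrC => /andP[h1 h2]; rewrite ger0_norm.
by have := key y x y0 h x1 xy xx => /andP[h1 h2]; rewrite ger0_norm.
Qed.

Lemma kappa_continuous_right (s : R) : 0 <= s -> s <= 1 ->
  {within `[0, 1], continuous (kappa s)}.
Proof.
move=> s0 s1; apply: within_itv_continuous => x e x0 x1 e0.
have [r r0 hr] := kappa_cont hflat s0 s1 x0 x1 e0.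
by exists r => // y y0 y1 xy; apply: hr => //; rewrite subrr normr0.
Qed.

Lemma diam_le (E : set R) (M : R) : 0 <= M ->
  (forall x y, E x -> E y -> kappa x y <= M) -> (diam kappa E <= M%:E)%E.
Proof.
move=> M0 h; apply: ge_ereal_sup => _ [->|[x Ex [y Ey <-]]]; rewrite lee_fin//.
exact: h.
Qed.

Lemma le_diam (E : set R) x y : E x -> E y -> ((kappa x y)%:E <= diam kappa E)%E.
Proof.
by move=> Ex Ey; apply: ereal_sup_ubound; right; exists x => //; exists y.
Qed.

Lemma diam_ge0 (E : set R) : (0 <= diam kappa E)%E.
Proof. by apply: ereal_sup_ubound; left. Qed.

(* Past its end the list is read as its last point [t], so that the pairs of
   consecutive points from there on are degenerate. *)
Section PartitionCover.
Variables (e t : R).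
Hypotheses (e0 : 0 <= e) (t0 : 0 <= t) (t1 : t <= 1).

Lemma fine_path_nth s c i : 0 <= s -> path (fine_step kappa e) s c -> last s c = t ->
  [/\ 0 <= nth t (s :: c) i, nth t (s :: c) i <= nth t c i,
      nth t c i <= 1 & kappa (nth t (s :: c) i) (nth t c i) <= e].
Proof.
elim: c s i => [|x c IH] s i s0 /=.
  move=> _ st; rewrite nth_nil (_ : nth t [:: s] i = t).
    by rewrite (kappaxx hflat).
  by case: i => [//|i]; rewrite /= nth_nil.
move=> /andP[/andP[sx ksx] pc] lc.
have x0 : 0 <= x by exact: le_trans sx.
case: i => [|i] /=; last exact: IH.
split => //; apply: le_trans t1; rewrite -lc.
by apply: path_le_last; apply: sub_path pc; exact: fine_step_le.
Qed.

Lemma fine_path_cover s c x : path (fine_step kappa e) s c -> last s c = t ->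
  s <= x -> x <= t -> exists i, nth t (s :: c) i <= x <= nth t c i.
Proof.
elim: c s => [|z c IH] s /=; first by move=> _ <- sx xs; exists 0%N; rewrite /= sx.
move=> /andP[_ pc] lc sx xt; have [xz|/ltW zx] := leP x z.
  by exists 0%N; rewrite /= sx.
by have [i hi] := IH z pc lc zx xt; exists i.+1.
Qed.

Lemma partial_kappa_sum_le s c n : 0 <= s -> path (fine_step kappa e) s c ->
  last s c = t ->
  \sum_(0 <= i < n) kappa (nth t (s :: c) i) (nth t c i) <= S s c.
Proof.
elim: c s n => [|z c IH] s n s0 /=.
  move=> _ st; rewrite kappa_sum_nil big1// => i _.
  rewrite nth_nil (_ : nth t [:: s] i = t) ?(kappaxx hflat)//.
  by case: i => [//|i]; rewrite /= nth_nil.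
move=> /andP[/andP[sz ksz] pc] lc.
have z0 : 0 <= z by exact: le_trans sz.
have zt : z <= t.
  by rewrite -lc; apply: path_le_last; apply: sub_path pc; exact: fine_step_le.
case: n => [|n]; last by rewrite big_nat_recl//= kappa_sum_cons lerD2l IH.
rewrite big_geq//; apply: (kappa_sum_ge0 hflat) => //=; first by rewrite lc.
by rewrite sz; apply: sub_path pc; exact: fine_step_le.
Qed.

End PartitionCover.

Lemma hausdorff1_content_le (eps s t : R) : 0 < eps -> 0 <= s -> s <= t -> t <= 1 ->
  (hausdorff1_content kappa eps `[s, t] <= (L t - L s)%:E)%E.
Proof.
move=> eps0 s0 st t1; apply/lee_addgt0Pr => e e0.
have D0 : 0 <= L t - L s by have := length_upto_le hflat hsum s0 st t1; lra.
(* With D = L t - L s, [length_path] gives S <= D + b S and S <= 2 D, so (1 + 2 b) S <= D + 3 b S <=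
   D + 6 b D. The added 1 keeps the denominator positive when D = 0. *)
pose b := Num.min (1 / 2) (e / (6 * (L t - L s + 1))).
have b0 : 0 < b by rewrite lt_min; apply/andP; split; [lra|apply: divr_gt0; lra].
have b2 : b <= 1 / 2 by rewrite ge_min lexx.
have be : 6 * b * (L t - L s) <= e.
  have : b <= e / (6 * (L t - L s + 1)) by rewrite ge_min lexx orbT.
  rewrite ler_pdivlMr; last lra.
  lra.
have [d d0 Bd] := @flat_bound_small R m hm hsum b b0.
(* The intervals of the cover have diameter at most [(1 + 2 * b) * v <= 2 * v], hence at most
   [eps]. *)
pose v := Num.min d (eps / 2).
have v0 : 0 < v by rewrite lt_min d0; lra.
have [vd veps] : v <= d /\ v <= eps / 2 by rewrite /v; split; rewrite ge_min lexx ?orbT.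
have Bv : B v <= b by apply: le_trans Bd; apply: (flat_bound_le hm hsum) => //; lra.
have Bv0 := flat_bound_ge0 hm (ltW v0).
have [c pc lc] := fine_path_exists hflat s0 st t1 v0.
have t0 : 0 <= t by lra.
pose p i := nth t (s :: c) i; pose q i := nth t c i.
have pq i : [/\ 0 <= p i, p i <= q i, q i <= 1 & kappa (p i) (q i) <= v].
  exact: (fine_path_nth (ltW v0) t0 t1 i s0 pc lc).
have k0 i : 0 <= kappa (p i) (q i).
  have [p0 pqi q1 _] := pq i.
  by apply: (kappa_ge0 hflat) => //; [exact: le_trans q1|exact: le_trans pqi].
have dl i : (diam kappa `[p i, q i] <= ((1 + 2 * b) * kappa (p i) (q i))%:E)%E.
  have [p0 pqi q1 kv] := pq i.
  have Bi : B (kappa (p i) (q i)) <= b.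
    by apply: le_trans Bv; apply: (flat_bound_le hm hsum).
  have key x y : p i <= x -> x <= y -> y <= q i ->
      kappa x y <= (1 + 2 * b) * kappa (p i) (q i).
    move=> px xy yq.
    apply: le_trans (sub_kappa_le hflat hsum p0 px xy yq q1 (le_trans Bi b2)) _.
    by rewrite ler_wpM2r//; lra.
  apply: diam_le => [|x y]; first by rewrite mulr_ge0//; lra.
  rewrite /= !in_itv/= => /andP[px xq] /andP[py yq].
  have [xy|/ltW yx] := leP x y; first exact: key.
  rewrite (kappaC hflat) ?key//.
  - exact: le_trans px.
  - exact: le_trans q1.
  - exact: le_trans py.
  - exact: le_trans q1.
apply: ge_ereal_inf; exists (\sum_(0 <= i <oo) diam kappa `[p i, q i])%E.
  exists (fun i => `[p i, q i]%classic) => //; split.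
  - move=> i x; have [p0 pqi q1 kv] := pq i.
    by rewrite /= !in_itv/= => /andP[/(le_trans p0)-> /le_trans->].
  - move=> x; rewrite /= in_itv/= => /andP[sx xt].
    have [i hi] := fine_path_cover pc lc sx xt.
    by exists i => //=; rewrite in_itv.
  - move=> i; apply: le_trans (dl i) _; rewrite lee_fin.
    have [_ _ _ kv] := pq i.
    apply: (@le_trans _ _ (2 * v)); last lra.
    by apply: ler_pM => //; lra.
have Sle : (1 + 2 * b) * S s c <= L t - L s + e.
  rewrite -lc in t1; have /andP[h _] := length_path hflat hsum s0 t1 (le_trans Bv b2) pc.
  rewrite lc in h t1.
  have S0 : 0 <= S s c.
    apply: (kappa_sum_ge0 hflat) => //; first by rewrite lc.
    by apply: sub_path pc; exact: fine_step_le.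
  have : B v * S s c <= b * S s c by rewrite ler_wpM2r.
  have bS : b * S s c <= 1 / 2 * S s c by rewrite ler_wpM2r.
  have : b * S s c <= b * (2 * (L t - L s)).
    by rewrite ler_wpM2l ?(ltW b0)//; have : B v * S s c <= b * S s c; [rewrite ler_wpM2r|lra].
  lra.
apply: lime_le; first by apply: is_cvg_nneseries => i _ _; exact: diam_ge0.
apply: nearW => n; apply: (@le_trans _ _ (\sum_(0 <= i < n)
    ((1 + 2 * b) * kappa (p i) (q i))%:E)%E).
  by apply: lee_sum => i _; exact: dl.
rewrite sumEFin -EFinD lee_fin -mulr_sumr; apply: le_trans Sle.
rewrite ler_wpM2l//; first lra.
exact: (partial_kappa_sum_le t0 t1 n s0 pc lc).
Qed.

(** The hull is [inf E, sup E]; its end points are limits of points of [E], so continuity bounds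
    their distance by the diameter. The whole hull may have a larger diameter, but the increment of
    [L] only sees the end points. *)
Lemma diam_hull (E : set R) : E `<=` `[0, 1] -> exists ab : R * R,
  [/\ 0 <= ab.1, ab.1 <= ab.2, ab.2 <= 1, E `<=` `[ab.1, ab.2] &
      ((kappa ab.1 ab.2)%:E <= diam kappa E)%E].
Proof.
move=> E01.
have [->|/set0P[x0 Ex0]] := eqVneq E set0.
  by exists (0, 0); split => //=; rewrite (kappaxx hflat) ?diam_ge0.
have h01 x : E x -> 0 <= x /\ x <= 1 by move=> /E01; rewrite /= in_itv/= => /andP[].
have ub : has_ubound E by exists 1 => x /h01[].
have lb : has_lbound E by exists 0 => x /h01[].
have hi x : E x -> inf E <= x by exact: ge_inf.
have hs x : E x -> x <= sup E by exact: ub_le_sup.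
have i0 : 0 <= inf E by apply: lb_le_inf; [exists x0|move=> x /h01[]].
have s1 : sup E <= 1 by apply: ge_sup; [exists x0|move=> x /h01[]].
have x0i := hi _ Ex0; have x0s := hs _ Ex0.
exists (inf E, sup E); split => //=; first lra.
  by move=> x Ex; rewrite /= in_itv/= hi//= hs.
apply/lee_addgt0Pr => e e0.
have i1 : inf E <= 1 by lra.
have s0 : 0 <= sup E by lra.
have [d d0 hd] := kappa_cont hflat i0 i1 s0 s1 e0.
have [x Ex xi] : exists2 x, E x & x < inf E + d.
  by apply: inf_adherent => //; split => //; exists x0.
have [y Ey ys] : exists2 y, E y & sup E - d < y.
  by apply: sup_adherent => //; split => //; exists x0.
have [x0' x1'] := h01 _ Ex; have [y0' y1'] := h01 _ Ey.
have xi' := hi _ Ex; have ys' := hs _ Ey.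
apply: (@le_trans _ _ ((kappa x y)%:E + e%:E)%E); last by rewrite leeD2r// le_diam.
rewrite -EFinD lee_fin.
have : `|kappa (inf E) (sup E) - kappa x y| < e.
  by apply: hd => //; [rewrite ler0_norm; lra|rewrite ger0_norm; lra].
rewrite ltr_norml => /andP[]; lra.
Qed.

Lemma hausdorff1_content_ge (eps s t : R) : 0 < eps -> B eps <= 1 / 2 ->
  0 <= s -> s <= t -> t <= 1 ->
  (((1 - 2 * B eps) * (L t - L s))%:E <= hausdorff1_content kappa eps `[s, t])%E.
Proof.
move=> eps0 Beps s0 st t1.
have B0 := flat_bound_ge0 hm (ltW eps0).
apply: le_ereal_inf_tmp => _ [F [F01 cov Feps] <-].
have [ab hab] := choice (fun i => diam_hull (F01 i)).
pose a i := (ab i).1; pose b i := (ab i).2.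
have Lst := length_upto_le hflat hsum s0 st t1.
have Lab i : L (a i) <= L (b i).
  by have [] := hab i => *; apply: (length_upto_le hflat hsum).
have inc i : ((L (b i) - L (a i))%:E <= (1 + 2 * B eps)%:E * diam kappa (F i))%E.
  have [a0 lab b1 _ kd] := hab i; rewrite -/(a i) -/(b i) in a0 lab b1 kd.
  have k0 : 0 <= kappa (a i) (b i) by apply: (kappa_ge0 hflat); lra.
  have keps : kappa (a i) (b i) <= eps by rewrite -lee_fin (le_trans kd).
  have Bk : B (kappa (a i) (b i)) <= B eps by apply: (flat_bound_le hm hsum).
  have /andP[_ h] := length_increment hflat hsum a0 lab b1 (le_trans Bk Beps).
  apply: (@le_trans _ _ ((1 + 2 * B eps)%:E * (kappa (a i) (b i))%:E)%E).
    rewrite -EFinM lee_fin; apply: le_trans h _.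
    by rewrite ler_wpM2r//; lra.
  by rewrite lee_wpmul2l// lee_fin; lra.
have mu01 (x y : R) : x <= y -> lebesgue_measure (`[x, y] : set R) = (y - x)%:E.
  rewrite le_eqVlt => /predU1P[->|xy]; last by rewrite lebesgue_measure_itv/= lte_fin xy -EFinB.
  by rewrite lebesgue_measure_itv/= lte_fin ltxx subrr.
(* Each value is [L x] with [x] in some set of the cover, and [L] is monotone on its hull. *)
have sub : `[L s, L t] `<=` \bigcup_i `[L (a i), L (b i)]%classic.
  move=> u; rewrite /= in_itv/= => /andP[Lu uL].
  have [x xst <-] : exists2 x, x \in `[s, t] & L x = u.
    apply: IVT => //.
      apply: continuous_subspaceW length_upto_continuous => x.
      by rewrite /= !in_itv/= => /andP[? ?]; apply/andP; split; lra.
    by rewrite min_l// max_r// Lu.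
  have [i _ Fix] := cov x xst.
  exists i => //; have [a0 lab b1 Fab _] := hab i.
  move: (Fab _ Fix); rewrite /= !in_itv/= => /andP[ax xb].
  by apply/andP; split; apply: (length_upto_le hflat hsum) => //; lra.
have h : (lebesgue_measure (`[L s, L t] : set R) <=
    \sum_(0 <= i <oo) lebesgue_measure (`[L (a i), L (b i)] : set R))%E.
  apply: (@measure_sigma_subadditive _ R (measurableTypeR R) lebesgue_measure) => //.
rewrite mu01// in h.
have {}h : ((L t - L s)%:E <= (1 + 2 * B eps)%:E *
    \sum_(0 <= i <oo) diam kappa (F i))%E.
  apply: le_trans h _; rewrite -nneseriesZl; last by move=> i _; exact: diam_ge0.
  apply: lee_nneseries => i _; first by rewrite mu01// lee_fin subr_ge0.
  by rewrite mu01.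
have c0 : 0 < 1 + 2 * B eps by lra.
(* The inequality used is (1 - 2 B)(1 + 2 B) = 1 - 4 B^2 <= 1. *)
apply: (@le_trans _ _ ((1 + 2 * B eps)^-1%:E * (L t - L s)%:E)%E).
  rewrite lee_pdivlMl// -EFinM lee_fin mulrA.
  rewrite -[leRHS]mul1r ler_wpM2r//; first lra.
  have := sqr_ge0 (B eps); rewrite expr2; lra.
by rewrite lee_pdivrMl.
Qed.

Lemma hausdorff1_itv (s t : R) : 0 <= s -> s <= t -> t <= 1 ->
  hausdorff1 kappa `[s, t] = (L t - L s)%:E.
Proof.
move=> s0 st t1; apply: cvg_lim => //.
have D0 : 0 <= L t - L s by have := length_upto_le hflat hsum s0 st t1; lra.
have [d d0 Bd] := @flat_bound_small R m hm hsum (1 / 2) ltac:(lra).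
apply: (@squeeze_cvge _ _ _ _ (fun e => ((1 - 2 * B e) * (L t - L s))%:E) _
  (cst (L t - L s)%:E)); last exact: cvg_cst.
  near=> e; have e0 : 0 < e by near: e; exact: nbhs_right_gt.
  rewrite hausdorff1_content_le// andbT hausdorff1_content_ge//.
  apply: le_trans Bd; apply: (flat_bound_le hm hsum); first exact: ltW.
  by near: e; exact: nbhs_right_le.
apply: cvg_EFin; first by apply: nearW.
apply/cvgrPdist_le => r r0.
have [u u0 Bu] := @flat_bound_small R m hm hsum (r / (2 * (L t - L s + 1)))
  ltac:(apply: divr_gt0; lra).
near=> e => /=; have e0 : 0 < e by near: e; exact: nbhs_right_gt.
have Be : B e <= r / (2 * (L t - L s + 1)).
  apply: le_trans Bu; apply: (flat_bound_le hm hsum); first exact: ltW.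
  by near: e; exact: nbhs_right_le.
have Be0 := flat_bound_ge0 hm (ltW e0).
have -> : L t - L s - (1 - 2 * B e) * (L t - L s) = 2 * B e * (L t - L s) by ring.
rewrite ger0_norm; last by apply: mulr_ge0 => //; exact: mulr_ge0.
move: Be; rewrite ler_pdivlMr; last lra.
lra.
Unshelve. all: by end_near.
Qed.

End Hausdorff.

(** * Estimates at all scales and convergence of the sums *)

Section Conclusion.
Variables (R : realType) (kappa : R -> R -> R) (m : R -> R).
Hypothesis hflat : flat_curve kappa m.
Hypothesis hsum : (\sum_(0 <= i <oo) (m (2 ^- i))%:E < +oo)%E.

Local Notation B := (flat_bound m).
Local Notation S := (kappa_sum kappa).
Local Notation L := (length_upto kappa).
Local Notation hm := (flat_modulus hflat).

(** Flatness bounds [kappa] on a subinterval sharing an end point by [1 + m] times the value on the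
    larger one; apply this to [0,t] in [0,1], then to [s,t] in [0,t]. *)
Lemma kappa_bounded : exists2 K, 0 <= K &
  forall s t, 0 <= s -> s <= t -> t <= 1 -> kappa s t <= K.
Proof.
case: (hflat) => _ _ [m0 mle _] hf.
have grow (x y z : R) : 0 <= x -> x <= y -> y <= z -> z <= 1 ->
    kappa x y <= (1 + m (kappa x z)) * kappa x z /\
    kappa y z <= (1 + m (kappa x z)) * kappa x z.
  move=> x0 xy yz z1; have := hf x y z x0 xy yz z1; rewrite ler_norml => /andP[_ h].
  have : 0 <= kappa x y by apply: (kappa_ge0 hflat); lra.
  have : 0 <= kappa y z by apply: (kappa_ge0 hflat); lra.
  by move=> *; split; lra.
have k01 : 0 <= kappa 0 1 by apply: (kappa_ge0 hflat).
pose K := (1 + m (kappa 0 1)) * kappa 0 1.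
have K0 : 0 <= K by rewrite mulr_ge0// addr_ge0// m0.
exists ((1 + m K) * K); first by rewrite mulr_ge0// addr_ge0// m0.
move=> s t s0 st t1; have t0 : 0 <= t by lra.
apply: le_trans (grow 0 s t _ _ _ _).2 _ => //.
have [h _] := grow 0 t 1 (lexx 0) t0 t1 (lexx 1).
have k0t : 0 <= kappa 0 t by apply: (kappa_ge0 hflat).
by apply: ler_pM => //; [rewrite addr_ge0// m0|rewrite lerD2l mle].
Qed.

Lemma length_comparable : exists2 C, 1 <= C & forall s t, 0 <= s -> s <= t -> t <= 1 ->
  C^-1 * kappa s t <= L t - L s <= C * kappa s t.
Proof.
have [K K0 hK] := kappa_bounded.
have [d d0 Bd] := @flat_bound_small R m hm hsum (1 / 4) ltac:(lra).
have T0 : 0 <= L 1 - L 0.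
  by have := length_upto_le hflat hsum (lexx 0) ler01 (lexx 1); lra.
have a0 : 0 <= (L 1 - L 0) / d by apply: divr_ge0; lra.
have b0 : 0 <= 2 * K / d by apply: divr_ge0; lra.
have small s t : 0 <= s -> s <= t -> t <= 1 -> kappa s t <= d ->
    kappa s t / 2 <= L t - L s <= 2 * kappa s t.
  move=> s0 st t1 kd.
  have k0 : 0 <= kappa s t by apply: (kappa_ge0 hflat); lra.
  have Bk : B (kappa s t) <= 1 / 4.
    by apply: le_trans Bd; apply: (flat_bound_le hm hsum).
  have /andP[h1 h2] := length_increment hflat hsum s0 st t1 ltac:(lra).
  have : B (kappa s t) * kappa s t <= 1 / 4 * kappa s t by rewrite ler_wpM2r.
  by move=> ?; apply/andP; split; lra.
(* The terms serve, in order, distances at most [d], the upper bound at larger distances, and the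
   lower bound there. *)
pose C := 2 + (L 1 - L 0) / d + 2 * K / d.
have C2 : 2 <= C by rewrite /C; lra.
exists C; first lra.
move=> s t s0 st t1.
have k0 : 0 <= kappa s t by apply: (kappa_ge0 hflat); lra.
have [kd|/ltW kd] := leP (kappa s t) d.
  have /andP[h1 h2] := small s t s0 st t1 kd.
  apply/andP; split.
    apply: le_trans h1; rewrite mulrC ler_wpM2l//.
    by rewrite lef_pV2 ?posrE; lra.
  by apply: le_trans h2 _; rewrite ler_wpM2r.
have Ls := length_upto_le hflat hsum (lexx 0) s0 (le_trans st t1).
have Lt := length_upto_le hflat hsum (le_trans s0 st) t1 (lexx 1).
apply/andP; split; last first.
  apply: (@le_trans _ _ ((L 1 - L 0) / d * kappa s t)).
    apply: (@le_trans _ _ ((L 1 - L 0) / d * d)); last by rewrite ler_wpM2l.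
    by rewrite divfK ?gt_eqF//; lra.
  by rewrite ler_wpM2r// /C; lra.
(* At large distances the interval contains a piece [s,u] at distance exactly [d], so the increment
   of [L] is at least [d / 2], while [kappa s t <= K]. *)
have [u ust ku] : exists2 u, u \in `[s, t] & kappa s u = d.
  apply: IVT => //.
    apply: continuous_subspaceW (kappa_continuous_right hflat s0 (le_trans st t1)) => x.
    by rewrite /= !in_itv/= => /andP[? ?]; apply/andP; split; lra.
  by rewrite (kappaxx hflat) ?(le_trans st)// min_l// max_r// (ltW d0).
move: ust; rewrite in_itv/= => /andP[su ut].
have /andP[h _] := small s u s0 su (le_trans ut t1) ltac:(by rewrite ku).
have Lu := length_upto_le hflat hsum (le_trans s0 su) ut t1.
rewrite ku in h; apply: (@le_trans _ _ (d / 2)); last lra.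
rewrite mulrC ler_pdivrMr; last lra.
apply: (@le_trans _ _ (d / 2 * (2 * K / d))); last by rewrite ler_wpM2l /C; lra.
have -> : d / 2 * (2 * K / d) = K by field; rewrite gt_eqF.
exact: hK.
Qed.

Lemma mesh_fine_path e d (a : R) c : 0 <= a -> last a c <= 1 ->
  (forall x y, 0 <= x -> x <= 1 -> 0 <= y -> y <= 1 -> `|x - y| < d -> kappa x y <= e) ->
  path <%R a c -> mesh a c < d -> path (fine_step kappa e) a c.
Proof.
move=> + + hd; elim: c a => [//|x c IH] a a0 /= c1 /andP[ax pc].
have x1 : x <= 1.
  by apply: le_trans c1; apply: path_le_last; apply: sub_path pc => ? ?; exact: ltW.
rewrite /mesh /= big_nat_recl//= gt_max => /andP[xad md].
rewrite /fine_step (ltW ax) hd//=; [|lra|lra|by rewrite distrC].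
by apply: IH => //; lra.
Qed.

Lemma kappa_sum_cvg_length :
  (S 0 s)%:E @[s --> mesh_to0 0 1] --> (L 1 - L 0)%:E.
Proof.
move=> A hN; have /nbhs_ballP[e /= e0 hA] : nbhs (L 1 - L 0) (fun r => A r%:E) by [].
have T0 : 0 <= L 1 - L 0.
  by have := length_upto_le hflat hsum (lexx 0) ler01 (lexx 1); lra.
(* With D = L 1 - L 0, the error is at most 2 b S <= 4 b D, which this choice puts below [e]; the
   added 1 makes the inequality strict. *)
pose b := Num.min (1 / 2) (e / (8 * (L 1 - L 0 + 1))).
have b0 : 0 < b by rewrite lt_min; apply/andP; split; [lra|apply: divr_gt0; lra].
have b2 : b <= 1 / 2 by rewrite ge_min lexx.
have be : 8 * b * (L 1 - L 0) < e.
  have : b <= e / (8 * (L 1 - L 0 + 1)) by rewrite ge_min lexx orbT.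
  rewrite ler_pdivlMr; last lra.
  lra.
have [v v0 Bv] := @flat_bound_small R m hm hsum b b0.
have Bv0 := flat_bound_ge0 hm (ltW v0).
have [d d0 hd] := kappa_near_diagonal hflat v0.
exists d => // c [[pc /eqP lc] md]; apply: hA; rewrite /ball/=.
have c1 : last 0 c <= 1 by rewrite lc.
have pc' := mesh_fine_path (lexx 0) c1 hd pc md.
have /andP[] := length_path hflat hsum (lexx 0) c1 (le_trans Bv b2) pc'.
rewrite lc.
have S0 : 0 <= S 0 c.
  by apply: (kappa_sum_ge0 hflat) => //; apply: sub_path pc' => ? ?; exact: fine_step_le.
have BS : B v * S 0 c <= b * S 0 c by rewrite ler_wpM2r.
have bS : b * S 0 c <= 1 / 2 * S 0 c by rewrite ler_wpM2r.
move=> h1 h2.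
have : b * S 0 c <= b * (2 * (L 1 - L 0)) by rewrite ler_wpM2l ?(ltW b0)//; lra.
by move=> ?; rewrite ltr_norml; apply/andP; split; lra.
Qed.

End Conclusion.

Theorem mainTheorem10 (R : realType) (kappa : R -> R -> R) (m : R -> R)
    (hflat : flat_curve kappa m)
    (hsum : (\sum_(0 <= i <oo) (m (2 ^- i))%:E < +oo)%E) :
  [/\ ahlfors1_regular kappa,
      (kappa_sum kappa 0 s)%:E @[s --> mesh_to0 0 1]
        --> hausdorff1 kappa `[0, 1] &
      exists2 C : R, 0 < C &
        forall s t : R, 0 <= s -> s <= t -> t <= 1 ->
          (`|hausdorff1 kappa `[s, t] - (kappa s t)%:E|
            <= (C * kappa s t)%:E * modulus_sum m C (kappa s t))%E].
Proof.
have hm := flat_modulus hflat.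
have [C C1 hC] := length_comparable hflat hsum.
split.
- exists C; first lra.
  move=> s t s0 st t1; rewrite (hausdorff1_itv hflat hsum)// !lee_fin.
  by have /andP[] := hC s t s0 st t1.
- rewrite (hausdorff1_itv hflat hsum)//; exact: (kappa_sum_cvg_length hflat hsum).
(* Here 12 = 2 * 6: the relative error is at most twice [flat_bound], itself at most
   [6 * fine_modulus_sum m (2 * kappa s t)]. The same constant dominates the 2 in the argument of
   the series. *)
exists (12 * C); first lra.
move=> s t s0 st t1; rewrite (hausdorff1_itv hflat hsum)//.
have k0 : 0 <= kappa s t by apply: (kappa_ge0 hflat); lra.
have kC : kappa s t <= C * kappa s t by rewrite ler_peMl.
rewrite (modulus_sumE hm hsum)//; last lra.
rewrite -EFinB abse_EFin -EFinM lee_fin.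
have M0 : 0 <= fine_modulus_sum m (2 * kappa s t).
  by apply: fine_modulus_sum_ge0 => //; lra.
have M12 : fine_modulus_sum m (2 * kappa s t) <= fine_modulus_sum m (12 * C * kappa s t).
  by apply: (fine_modulus_sum_le hm hsum); lra.
apply: (@le_trans _ _ (12 * C * kappa s t * fine_modulus_sum m (2 * kappa s t))).
  2: by rewrite ler_wpM2l//; lra.
have [Bk|/ltW Bk] := leP (flat_bound m (kappa s t)) (1 / 2).
  have /andP[h1 h2] := length_increment hflat hsum s0 st t1 Bk.
  have hB := flat_bound_le_modulus_sum hm hsum k0.
  have B0 := flat_bound_ge0 hm k0.
  apply: (@le_trans _ _ (2 * flat_bound m (kappa s t) * kappa s t)).
    have : 0 <= flat_bound m (kappa s t) * kappa s t by rewrite mulr_ge0.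
    by move=> ?; rewrite ler_norml; apply/andP; split; lra.
  apply: (@le_trans _ _ (12 * fine_modulus_sum m (2 * kappa s t) * kappa s t)).
    by rewrite ler_wpM2r//; lra.
  have : fine_modulus_sum m (2 * kappa s t) * kappa s t <=
      fine_modulus_sum m (2 * kappa s t) * (C * kappa s t) by rewrite ler_wpM2l.
  lra.
(* When [flat_bound] is at least [1 / 2], the series is bounded below, and the crude error
   [C * kappa s t] from [length_comparable] already suffices. *)
have M1 : 1 / 12 <= fine_modulus_sum m (2 * kappa s t).
  by have := flat_bound_le_modulus_sum hm hsum k0; lra.
have /andP[h1 h2] := hC s t s0 st t1.
have h0 : 0 <= C^-1 * kappa s t by rewrite mulr_ge0// invr_ge0; lra.
apply: (@le_trans _ _ (C * kappa s t)).
  by rewrite ler_norml; apply/andP; split; lra.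
have : C * kappa s t * (1 / 12) <= C * kappa s t * fine_modulus_sum m (2 * kappa s t).
  by rewrite ler_wpM2l//; lra.
lra.
Qed.
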